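(* Let $\mathbb K$ be an algebraically closed field of characteristic zero, and let $s=hk$ be the operator defined in the context, acting on finite-dimensional $\mathfrak{sl}_2(\mathbb K)$-modules. Then $s$ is a skew operator; that is, on every finite-dimensional $\mathfrak{sl}_2(\mathbb K)$-module, $s^2=I$, $sX=-Xs$, $sY=Ys$ and $sZ=-Zs$.
   Context: Let $\mathbf i\in\mathbb K$ with $\mathbf i^2=-1$. $\mathfrak{sl}_2(\mathbb K)$ is the Lie algebra with basis $X,Y,Z$ and bracket $[X,Y]=2\mathbf iZ$, $[Y,Z]=2\mathbf iX$, $[Z,X]=2\mathbf iY$. On every finite-dimensional $\mathfrak{sl}_2(\mathbb K)$-module the operators $N_\pm=\tfrac12(\mathbf iY\pm X)$ act nilpotently, so $\exp(N_\pm)$ is a finite sum; define $h=\exp(N_-)\exp(N_+)\exp(N_-)$. Let $k$ be the linear operator on finite-dimensional $\mathfrak{sl}_2(\mathbb K)$-modules acting as $1$ on each odd-dimensional irreducible submodule and as $-\mathbf i$ on each even-dimensional irreducible submodule (well defined by complete reducibility). Set $s=hk$. A skew operator is a linear operator $\sigma$ on finite-dimensional $\mathfrak{sl}_2(\mathbb K)$-modules with $\sigma^2=I$, $\sigma X=-X\sigma$, $\sigma Y=Y\sigma$, $\sigma Z=-Z\sigma$. *)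

(* Defs.v *)
From mathcomp Require Import all_boot all_order all_algebra ring.
From mathcomp Require Import mathcomp_extra boolp classical_sets.

Set Implicit Arguments.
Unset Strict Implicit.
Unset Printing Implicit Defensive.

Import GRing.Theory.
Local Open Scope ring_scope.

(* sl_2(K) is carried by K^3, the standard basis being X, Y, Z.  The indices
   j + 1 and j + 2 are taken in Z/3, so [u, v] is 2i times the cross product. *)
Section LieAlgebra.
Variables (K : fieldType) (im : K).

Definition sl2X : 'rV[K]_3 := delta_mx 0 0.
Definition sl2Y : 'rV[K]_3 := delta_mx 0 1.
Definition sl2Z : 'rV[K]_3 := delta_mx 0 2%:R.

Definition sl2_bracket (u v : 'rV[K]_3) : 'rV[K]_3 :=
  \row_(j < 3) (2%:R * im *
    (u 0 (j + 1) * v 0 (j + 2%:R) - u 0 (j + 2%:R) * v 0 (j + 1))).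

End LieAlgebra.

Section LieAlgebraFacts.
Variables (K : fieldType) (im : K).
Local Notation br := (sl2_bracket im).

Lemma sl2_bracketXY : br (sl2X K) (sl2Y K) = (2%:R * im) *: sl2Z K.
Proof. by apply/rowP => -[[|[|[|n]]] h] //; rewrite !mxE /=; ring. Qed.

Lemma sl2_bracketYZ : br (sl2Y K) (sl2Z K) = (2%:R * im) *: sl2X K.
Proof. by apply/rowP => -[[|[|[|n]]] h] //; rewrite !mxE /=; ring. Qed.

Lemma sl2_bracketZX : br (sl2Z K) (sl2X K) = (2%:R * im) *: sl2Y K.
Proof. by apply/rowP => -[[|[|[|n]]] h] //; rewrite !mxE /=; ring. Qed.

Lemma sl2_bracket_linearl a u1 u2 v :
  br (a *: u1 + u2) v = a *: br u1 v + br u2 v.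
Proof. by apply/rowP => j; rewrite !mxE; ring. Qed.

Lemma sl2_bracketxx u : br u u = 0.
Proof. by apply/rowP => j; rewrite !mxE; ring. Qed.

Lemma sl2_bracketC u v : br u v = - br v u.
Proof. by apply/rowP => j; rewrite !mxE; ring. Qed.

Lemma sl2_jacobi u v w :
  br u (br v w) + br v (br w u) + br w (br u v) = 0.
Proof.
have E1 (j : 'I_3) : j + 1 + 1 = j + 2%:R by rewrite -addrA.
have E2 (j : 'I_3) : j + 1 + 2%:R = j.
  by rewrite -addrA -[RHS]addr0; congr (_ + _); apply/val_inj.
have E3 (j : 'I_3) : j + 2%:R + 1 = j.
  by rewrite -addrA -[RHS]addr0; congr (_ + _); apply/val_inj.
have E4 (j : 'I_3) : j + 2%:R + 2%:R = j + 1.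
  by rewrite -addrA; congr (_ + _); apply/val_inj.
by apply/rowP => j; rewrite !mxE !(E1, E2, E3, E4); ring.
Qed.

End LieAlgebraFacts.

Section LinearOperators.
Variables (K : fieldType) (V : vectType K).

Definition lfun_pow (N : 'End(V)) (n : nat) : 'End(V) :=
  iter n (comp_lfun N) \1%VF.

(* The exponential of a nilpotent operator.  Cutting the series at dim V loses
   nothing for nilpotent N: see lfun_exp_nilpotent. *)
Definition lfun_exp (N : 'End(V)) : 'End(V) :=
  \sum_(n < (\dim {:V}).+1) (n`!%:R)^-1 *: lfun_pow N n.

Lemma lfun_powS N n : lfun_pow N n.+1 = (N \o lfun_pow N n)%VF.
Proof. by []. Qed.

Lemma lfun_pow_dim N m :
  lfun_pow N m = 0 -> lfun_pow N (\dim {:V}) = 0.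
Proof.
move=> Nm.
pose I n := (lfun_pow N n @: fullv)%VS.
have IS n : I n.+1 = (N @: I n)%VS by rewrite /I lfun_powS limg_comp.
have sub n : (I n.+1 <= I n)%VS.
  elim: n => [|n IH]; first by rewrite {2}/I /= lim1g subvf.
  by rewrite (IS n.+1) {2}(IS n) limgS.
have Im0 : I m = 0%VS by rewrite /I Nm lim0g.
have stab n : I n.+1 = I n -> I n = 0%VS.
  move=> e; have st p : I (p + n)%N = I n.
    by elim: p => // p IH; rewrite addSn IS IH -IS.
  have sm p : I (p + m)%N = 0%VS.
    by elim: p => // p IH; rewrite addSn IS IH limg0.
  by rewrite -(st m) addnC sm.
have bound n : (I n == 0%VS) || (\dim (I n) + n <= \dim {:V})%N.
  elim: n => [|n /orP[/eqP e|IH]]; first by rewrite addn0 dimvS ?subvf ?orbT.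
    by rewrite IS e limg0 eqxx.
  case: (eqVneq (I n.+1) (I n)) => [e|ne]; first by rewrite e (stab n e) eqxx.
  apply/orP; right; apply: leq_trans IH; rewrite addnS ltn_add2r.
  by rewrite ltnNge; apply: contra ne => le; rewrite eqEdim sub.
have /orP[/eqP I0|] := bound (\dim {:V}).
  by apply/lfunP => v; rewrite lfunE /=; apply/eqP; rewrite -memv0 -I0 memv_img ?memvf.
rewrite -[X in (_ <= X)%N]add0n leq_add2r leqn0 dimv_eq0 => /eqP I0.
by apply/lfunP => v; rewrite lfunE /=; apply/eqP; rewrite -memv0 -I0 memv_img ?memvf.
Qed.

Lemma lfun_exp_nilpotent N m :
  lfun_pow N m = 0 ->
  lfun_exp N = \sum_(n < m) (n`!%:R)^-1 *: lfun_pow N n.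
Proof.
move=> Nm; have Nd := lfun_pow_dim Nm.
have up p q : lfun_pow N p = 0 -> (p <= q)%N -> lfun_pow N q = 0.
  move=> Np /subnK <-; elim: (q - p)%N => // r IH.
  by rewrite addSn lfun_powS IH comp_lfun0r.
have ext p q : lfun_pow N p = 0 -> (p <= q)%N ->
    \sum_(n < q) (n`!%:R)^-1 *: lfun_pow N n =
    \sum_(n < p) (n`!%:R)^-1 *: lfun_pow N n.
  move=> Np le.
  rewrite -!(big_mkord xpredT (fun n => (n`!%:R)^-1 *: lfun_pow N n)).
  rewrite (@big_cat_nat _ _ _ p 0 q) //= [X in _ + X]big_nat_cond.
  rewrite [X in _ + X]big1 ?addr0 // => n /andP[/andP[pn _] _].
  by rewrite (up p n) ?scaler0.
rewrite /lfun_exp (ext _ _ Nd) //.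
by case: (leqP m (\dim {:V})) => [/(ext _ _ Nm)|/ltnW/(ext _ _ Nd)].
Qed.

End LinearOperators.

Section Modules.
Variables (K : fieldType) (im : K).

Record sl2_module := Sl2Module {
  sl2_space :> vectType K;
  sl2_act : {linear 'rV[K]_3 -> 'End(sl2_space)};
  sl2_act_bracket : forall u v : 'rV[K]_3,
    sl2_act (sl2_bracket im u v) =
      (sl2_act u \o sl2_act v)%VF - (sl2_act v \o sl2_act u)%VF
}.

Definition opX (M : sl2_module) : 'End(M) := sl2_act M (sl2X K).
Definition opY (M : sl2_module) : 'End(M) := sl2_act M (sl2Y K).
Definition opZ (M : sl2_module) : 'End(M) := sl2_act M (sl2Z K).

Definition submodule (M : sl2_module) (U : {vspace M}) : Prop :=
  forall u : 'rV[K]_3, (sl2_act M u @: U <= U)%VS.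

Definition irreducible_submodule (M : sl2_module) (U : {vspace M}) : Prop :=
  [/\ submodule U, U != 0%VS &
      forall W : {vspace M}, submodule W -> (W <= U)%VS -> W = 0%VS \/ W = U].

Definition module_operator := forall M : sl2_module, 'End(M).

Definition Nplus : module_operator :=
  fun M => 2%:R^-1 *: (im *: opY M + opX M).
Definition Nminus : module_operator :=
  fun M => 2%:R^-1 *: (im *: opY M - opX M).

Definition op_h : module_operator := fun M =>
  (lfun_exp (Nminus M) \o lfun_exp (Nplus M) \o lfun_exp (Nminus M))%VF.

Definition is_op_k (M : sl2_module) (k : 'End(M)) : Prop :=
  forall U : {vspace M}, irreducible_submodule U ->
  forall v, v \in U -> k v = if odd (\dim U) then v else - im *: v.

(* The operator satisfying is_op_k, or 0 if there were none.  Existence and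
   uniqueness follow from complete reducibility when K is algebraically closed
   of characteristic 0. *)
Definition op_k : module_operator := fun M =>
  xget (0 : 'End(M)) [set k | is_op_k k]%classic.

Definition op_s : module_operator := fun M => (op_h M \o op_k M)%VF.

Definition skew_operator (sigma : module_operator) : Prop :=
  forall M : sl2_module,
    [/\ (sigma M \o sigma M)%VF = \1%VF,
        (sigma M \o opX M)%VF = - (opX M \o sigma M)%VF,
        (sigma M \o opY M)%VF = (opY M \o sigma M)%VF &
        (sigma M \o opZ M)%VF = - (opZ M \o sigma M)%VF].

End Modules.

(* Main.v *)
(* Put E = N+, F = - N- and H = Z.  These form a standard sl2-triple, and
   h = exp(-F) exp(E) exp(-F) is the Weyl element: conjugating by the
   exponentials gives h E = - F h, h F = - E h and h H = - H h, which for
   X = E + F and Y = i (F - E) reads h X = - X h, h Y = Y h, h Z = - Z h.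

   The vectors F^j v with E v = 0 and H v = m v span the module, since an
   extension by a further highest weight vector splits off: the eigenvalues of H
   on T / E T are nonpositive, T being their span.  For such v != 0 the
   vectors v, F v, ..., F^m v are a basis of an irreducible submodule, and every
   irreducible submodule has this form.  From the braid relation
   h = exp(E) exp(-F) exp(E) one reads off h v = (-F)^m v / m!, hence
   h^2 = (-1)^m on this submodule.

   So k = (1 - i) / 2 + (1 + i) / 2 h^2.  Therefore k commutes with X, Y, Z
   and h, and s^2 = h^2 k^2 is 1 on every irreducible submodule. *)
From HB Require Import structures.
Require Import Defs.
From mathcomp Require Import all_boot all_order all_algebra.
From mathcomp Require Import mathcomp_extra boolp classical_sets.
From mathcomp Require Import ring zify.

Set Implicit Arguments.
Unset Strict Implicit.
Unset Printing Implicit Defensive.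

Import GRing.Theory.
Local Open Scope ring_scope.

(** * Coordinates of vectors *)

Section Coordinates.
Import VectorInternalTheory.
Variables (K : fieldType) (V : vectType K).

Definition coordinate i (v : V) : K := v2r v 0 i.

Lemma coordinateP (v w : V) :
  (forall i, coordinate i v = coordinate i w) -> v = w.
Proof. by move=> e; apply: v2r_inj; apply/rowP. Qed.

Lemma coordinateE i : (coordinate i 0 = 0) *
  ((forall v w, coordinate i (v + w) = coordinate i v + coordinate i w) *
   (forall v, coordinate i (- v) = - coordinate i v) *
   (forall c v, coordinate i (c *: v) = c * coordinate i v)).
Proof. by rewrite /coordinate; do !split=> *;
  rewrite ?linear0 ?linearD ?linearN ?linearZ /= !mxE. Qed.

End Coordinates.

(* [ring] does not apply to modules, so vector identities are proved on
   coordinates. *)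
Ltac vring := apply: coordinateP => ?; rewrite ?coordinateE; ring.

(** * Products of shifts of an endomorphism *)

Section Spectral.
Variables (K : fieldType) (V : vectType K).
Implicit Types (A : 'End(V)) (W : {vspace V}) (v : V) (s : seq K).

Definition stable A W := forall v, v \in W -> A v \in W.

Lemma stable0 A : stable A 0%VS.
Proof. by move=> v; rewrite memv0 => /eqP->; rewrite linear0 mem0v. Qed.

Lemma iter_stable A W n v : stable A W -> v \in W -> iter n A v \in W.
Proof. by move=> sA vW; elim: n => // n IH; apply: sA. Qed.

Lemma iter_lfun A n v : lfun_pow A n v = iter n A v.
Proof. by elim: n v => [|n IH] v;
  rewrite ?id_lfunE // lfun_powS comp_lfunE IH. Qed.

Lemma iter_lfunD A n v w : iter n A (v + w) = iter n A v + iter n A w.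
Proof. by rewrite -!iter_lfun linearD. Qed.

Lemma iter_lfunZ A n c v : iter n A (c *: v) = c *: iter n A v.
Proof. by rewrite -!iter_lfun linearZ. Qed.

Lemma iter_lfun0 A n : iter n A 0 = 0.
Proof. by rewrite -iter_lfun linear0. Qed.

(** A polynomial in [A], given by the list of its roots; coprimality then means that the lists are
    disjoint. *)
Definition shifts A s : 'End(V) :=
  foldr (fun a P => ((A - a *: \1) \o P)%VF) \1%VF s.

Lemma shifts_nil A v : shifts A [::] v = v.
Proof. exact: id_lfunE. Qed.

Lemma shifts_cons A a s v :
  shifts A (a :: s) v = A (shifts A s v) - a *: shifts A s v.
Proof. by rewrite /= !lfun_simp. Qed.

Lemma shiftsC A s v : A (shifts A s v) = shifts A s (A v).
Proof.
elim: s => [|a s IH]; first by rewrite !shifts_nil.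
by rewrite !shifts_cons -IH linearB linearZ.
Qed.

Lemma shifts_consr A a s v : shifts A (a :: s) v = shifts A s (A v - a *: v).
Proof. by rewrite shifts_cons shiftsC -linearZ -linearB. Qed.

Lemma shifts_rcons A a s v : shifts A (rcons s a) v = shifts A s (A v - a *: v).
Proof.
elim: s => [|b s IH]; last by rewrite rcons_cons !shifts_cons IH.
by rewrite /= !lfun_simp.
Qed.

Lemma shifts_comm A s t v :
  shifts A t (shifts A s v) = shifts A s (shifts A t v).
Proof.
elim: t => [|b t IH]; first by rewrite !shifts_nil.
by rewrite shifts_cons IH shifts_cons shiftsC -linearZ -linearB.
Qed.

Lemma shifts_stable A W s : stable A W -> stable (shifts A s) W.
Proof.
move=> sA v vW; elim: s => [|a s IH]; first by rewrite shifts_nil.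
by rewrite shifts_cons memvB ?sA ?memvZ.
Qed.

Lemma shifts_eigen_mod A W a s v : stable A W -> A v - a *: v \in W ->
  shifts A s v - (\prod_(b <- s) (a - b)) *: v \in W.
Proof.
move=> sA vW; elim: s => [|b s IH].
  by rewrite shifts_nil big_nil scale1r subrr mem0v.
rewrite shifts_cons big_cons; set p := \prod_(_ <- _) _ in IH *.
set w := shifts A s v in IH *.
have -> : A w - b *: w - ((a - b) * p) *: v =
  A (w - p *: v) - b *: (w - p *: v) + p *: (A v - a *: v).
  by rewrite [A (_ - _)]linearB /= [A (_ *: _)]linearZ /=; vring.
by rewrite memvD ?memvB ?sA ?memvZ.
Qed.

Lemma shifts_eigen A a s v :
  A v = a *: v -> shifts A s v = (\prod_(b <- s) (a - b)) *: v.
Proof.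
move=> Av; apply/eqP; rewrite -subr_eq0 -memv0.
by apply: shifts_eigen_mod; [apply: stable0 | rewrite Av subrr mem0v].
Qed.

Lemma prod_sub_eq0 a s : (\prod_(b <- s) (a - b) == 0) = (a \in s).
Proof.
elim: s => [|b s IH]; first by rewrite big_nil oner_eq0.
by rewrite big_cons mulf_eq0 subr_eq0 IH in_cons.
Qed.

Lemma shifts_eigen_eq0 A a s v : A v = a *: v -> a \in s -> shifts A s v = 0.
Proof.
by move=> /shifts_eigen->; rewrite -prod_sub_eq0 => /eqP->; rewrite scale0r.
Qed.

Lemma memv_shift_coprime A W a s v : stable A W -> a \notin s ->
  A v - a *: v \in W -> shifts A s v \in W -> v \in W.
Proof.
move=> sA; rewrite -prod_sub_eq0 => p0 /(shifts_eigen_mod s sA) vW sW.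
have := memvB sW vW; rewrite opprB addrC subrK.
by move/(memvZ (\prod_(b <- s) (a - b))^-1); rewrite scalerA mulVf ?scale1r.
Qed.

(** The roots in [s] are peeled off one at a time: the vector left is zero or an eigenvector in V /
    W, on which the polynomial of [t] acts by a nonzero scalar. *)
Lemma memv_shifts_coprime A W s t v : stable A W -> {in s, forall a,
  a \notin t} ->
  shifts A s v \in W -> shifts A t v \in W -> v \in W.
Proof.
move=> sA; elim: s => [|a s IH] st; first by rewrite shifts_nil.
rewrite shifts_cons => sW tW; apply: IH => // [b bs|].
  by apply: st; rewrite in_cons bs orbT.
apply: (memv_shift_coprime sA _ sW); first by apply: st; rewrite mem_head.
by rewrite shifts_comm; apply: shifts_stable.
Qed.

(** Simple roots make [v] a sum of eigenvectors of [A] lying in [U]; a stable [W] holding all of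
    these replaces the explicit sum. *)
Lemma memv_sum_eigen A U W s v : stable A U -> stable A W -> uniq s ->
  (forall a x, a \in s -> x \in U -> A x = a *: x -> x \in W) ->
  v \in U -> shifts A s v = 0 -> v \in W.
Proof.
move=> sU sW; elim: s v => [|a s IH] v;
  first by rewrite shifts_nil => _ _ _ ->; rewrite mem0v.
move=> /= /andP[as_ us] eW vU sv.
apply: (memv_shift_coprime sW as_).
  apply: IH => //; first by move=> b x bs; apply: eW; rewrite in_cons bs orbT.
    by rewrite memvB ?sU ?memvZ.
  by rewrite -shifts_consr.
apply: (eW a); rewrite ?mem_head //; first exact: shifts_stable.
by apply/eqP; rewrite -subr_eq0 -shifts_cons sv.
Qed.

Lemma shifts_eq0_eigen A U s v : stable A U -> v \in U -> v != 0 ->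
  shifts A s v = 0 -> exists a x, [/\ a \in s, x \in U, x != 0 & A x = a *: x].
Proof.
move=> sU vU v0; elim: s => [|a s IH]; first by rewrite shifts_nil => e;
  rewrite e eqxx in v0.
rewrite shifts_cons => /eqP; rewrite subr_eq0 => /eqP e.
have [/IH[b [x [bs xU x0 Ax]]]|w0] := eqVneq (shifts A s v) 0.
  by exists b, x; split; rewrite // in_cons bs orbT.
exists a, (shifts A s v); split; rewrite ?mem_head //; exact: shifts_stable.
Qed.

Lemma span_shifts A (w : nat -> V) (a : nat -> K) n v :
  (forall i, A (w i) = a i *: w i) -> v \in <<mkseq w n>>%VS ->
  shifts A (mkseq a n) v = 0.
Proof.
move=> Aw; suff /subvP/[apply] : (<<mkseq w n>> <= lker (shifts A (mkseq a
  n)))%VS.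
  by rewrite memv_ker => /eqP.
apply/span_subvP => x /mapP[i ii ->]; rewrite memv_ker; apply/eqP.
by apply: shifts_eigen_eq0 (Aw i) _; apply: map_f.
Qed.

(** If [w n] were in the span of its predecessors, the product of the A - a_i over i < n would kill
    it, yet this product scales it by a nonzero number. *)
Lemma eigen_free A (w : nat -> V) (a : nat -> K) n : injective a ->
  (forall i, A (w i) = a i *: w i) -> (forall i, (i < n)%N -> w i != 0) ->
  free (mkseq w n).
Proof.
move=> ia Aw; elim: n => [|n IH] w0; first exact: nil_free.
rewrite mkseqS (perm_free (Y := w n :: mkseq w n)) ?perm_rcons //.
rewrite free_cons IH ?andbT => [|i /ltnW/w0//].
apply/negP => /(span_shifts Aw); rewrite (shifts_eigen _ (Aw n)).
move/eqP; rewrite scaler_eq0 (negPf (w0 n _)) // orbF prod_sub_eq0.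
by case/mapP => i; rewrite mem_iota => /andP[_ lin] /ia e; move: lin;
  rewrite -e ltnn.
Qed.

End Spectral.

(** * Nilpotency of eigenvectors of ad H *)

Section Nilpotent.
Variables (K : fieldType) (V : vectType K).
Hypothesis char0 : forall n, n.+1%:R != 0 :> K.

Lemma natr_inj m n : m%:R = n%:R :> K -> m = n.
Proof.
wlog le : m n / (m <= n)%N.
  by move=> W e; case/orP: (leq_total m n) => le; [|symmetry]; apply: W.
move=> e; have : (n - m)%:R = 0 :> K by rewrite natrB // e subrr.
case d : (n - m)%N => [|p]; last by move=> /eqP; rewrite (negPf (char0 p)).
by move=> _; apply/eqP; rewrite eqn_leq le -subn_eq0 d.
Qed.

(* The powers of [A] are eigenvectors of [ad H] for the pairwise distinct
   eigenvalues [n * c], so only finitely many of them are nonzero. *)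
Lemma ad_eigen_nilpotent (H A : 'End(V)) c : c != 0 ->
  (forall v, H (A v) = A (H v) + c *: A v) -> forall v,
    iter (\dim {:V}) A v = 0.
Proof.
move=> c0 HA v; rewrite -iter_lfun (_ : lfun_pow A _ = 0) ?zero_lfunE //.
(* Any vanishing power suffices, since [lfun_pow_dim] lowers its exponent to dim V. *)
suff [n _ An] : exists2 n, (n <= \dim {: 'End(V)})%N & lfun_pow A n = 0.
  exact: lfun_pow_dim An.
pose d := \dim {: 'End(V)}.
pose ad : 'End(V) -> 'End(V) := fun B => (H \o B)%VF - (B \o H)%VF.
have ad_lin : linear ad.
  by move=> k B C; apply/lfunP => x;
    rewrite /ad !lfun_simp [H (_ + _)]linearD /= [H (_ *: _)]linearZ /=; vring.
pose adM := GRing.isLinear.Build _ _ _ _ ad ad_lin.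
pose adL : {linear 'End(V) -> 'End(V)} := HB.pack ad adM.
have adE n : (linfun adL) (lfun_pow A n) = (n%:R * c) *: lfun_pow A n.
  rewrite lfunE /= /ad; apply/lfunP => x; rewrite !lfun_simp !iter_lfun.
  elim: n => [|n IH]; first by rewrite mul0r scale0r subrr.
  have {}IH : H (iter n A x) = iter n A (H x) + (n%:R * c) *: iter n A x.
    by rewrite -IH addrC subrK.
  by rewrite /= HA IH [A (_ + _)]linearD /= [A (_ *: _)]linearZ /= -natr1; vring.
apply: contrapT => nz.
have : free (mkseq (lfun_pow A) d.+1).
  apply: (@eigen_free _ _ (linfun adL) _ (fun n => n%:R * c)) =>
    [m n /(mulIf c0)/natr_inj//|//|i].
  by rewrite ltnS => le; apply/eqP => Ai; apply: nz; exists i.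
rewrite /free size_mkseq => /eqP e.
by have := dimvS (subvf <<mkseq (lfun_pow A) d.+1>>); rewrite e ltnn.
Qed.

End Nilpotent.

(** * Exponentials of nilpotent endomorphisms *)

Section Exponential.
Variables (K : fieldType) (V : vectType K).
Hypothesis char0 : forall n, n.+1%:R != 0 :> K.
Implicit Types (N A B C : 'End(V)) (W : {vspace V}) (v : V).

Lemma factr_neq0 n : n`!%:R != 0 :> K.
Proof. by case: n`! (fact_gt0 n). Qed.

Lemma lfun_expE N m v : (forall x, iter m N x = 0) ->
  lfun_exp N v = \sum_(n < m) (n`!%:R)^-1 *: iter n N v.
Proof.
move=> Nm; rewrite (@lfun_exp_nilpotent _ _ _ m).
  by rewrite sum_lfunE; apply: eq_bigr => i _; rewrite scale_lfunE iter_lfun.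
by apply/lfunP => x; rewrite iter_lfun Nm zero_lfunE.
Qed.

Lemma iter_lfunN N m v : iter m (- N) v = (-1) ^+ m *: iter m N v.
Proof.
elim: m => [|m IH]; first by rewrite scale1r.
by rewrite /= IH opp_lfunE linearZ -scaleN1r scalerA exprS.
Qed.

Definition nilpotent N := forall v, iter (\dim {:V}) N v = 0.

Lemma nilpotentN N : nilpotent N -> nilpotent (- N).
Proof. by move=> nN v; rewrite iter_lfunN nN scaler0. Qed.

Lemma nilpotent_addn N m v : nilpotent N -> iter (m + \dim {:V}) N v = 0.
Proof. by move=> nN; rewrite iterD nN iter_lfun0. Qed.

Lemma nilpotent_expE N m v : nilpotent N -> iter m N v = 0 ->
  lfun_exp N v = \sum_(n < m) (n`!%:R)^-1 *: iter n N v.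
Proof.
move=> nN Nv; rewrite (@lfun_expE N (m + \dim {:V})) => [|x];
  last exact: nilpotent_addn.
rewrite big_split_ord /= [X in _ + X]big1 ?addr0 // => i _.
by rewrite addnC iterD Nv iter_lfun0 scaler0.
Qed.

(** Leibniz rule for ad N, with B = [N, A], C = [N, B] and [N, C] = 0; the coefficients are the
    binomials of n + 2 over 0, 1 and 2. *)
Lemma iter_comm2 N A B C :
  (forall v, N (A v) = A (N v) + B v) -> (forall v, N (B v) = B (N v) + C v) ->
  (forall v, N (C v) = C (N v)) ->
  forall n v, iter n.+2 N (A v) = A (iter n.+2 N v) +
    n.+2%:R *: B (iter n.+1 N v) + (2%:R^-1 * n.+2%:R * n.+1%:R) *: C (iter n N v).
Proof.
move=> NA NB NC n v.
have ND x y : N (x + y) = N x + N y by rewrite linearD.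
have NZ c x : N (c *: x) = c *: N x by rewrite linearZ.
elim: n => [|n IH].
  by rewrite /= !(NA, NB, ND) /= mulVf ?char0 // mulr1 scale1r; vring.
rewrite iterS IH !(ND, NZ, NA, NB, NC).
rewrite -!iterS; apply: coordinateP => i.
by rewrite !coordinateE; field; exact: char0.
Qed.

(* exp(N) A exp(-N) = A + [N, A] + [N, [N, A]] / 2 when the next bracket
   vanishes. *)
Lemma exp_conj2 N A B C : nilpotent N ->
  (forall v, N (A v) = A (N v) + B v) -> (forall v, N (B v) = B (N v) + C v) ->
  (forall v, N (C v) = C (N v)) ->
  forall v, lfun_exp N (A v) =
    A (lfun_exp N v) + B (lfun_exp N v) + 2%:R^-1 *: C (lfun_exp N v).
Proof.
move=> nN NA NB NC v; pose d := \dim {:V}.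
have eN k w : lfun_exp N w = \sum_(n < k + d) (n`!%:R)^-1 *: iter n N w.
  by apply: lfun_expE => x; apply: nilpotent_addn.
have fS n : (n.+1`!%:R)^-1 * n.+1%:R = (n`!%:R)^-1 :> K.
  by rewrite factS natrM invfM mulrAC mulVf ?mul1r.
(* The series are cut at different lengths, so that the terms in [A], [B] and [C] match those of the
   Leibniz rule after index shifts by 0, 1 and 2. *)
rewrite {1}(eN 2 (A v)) {1}(eN 2 v) {1}(eN 1 v) (eN 0 v).
rewrite !linear_sum /= !add0n add1n add2n !big_ord_recl /=.
have -> : \sum_(i < d) (((bump 0 (bump 0 i))`!%:R)^-1 : K) *: N (N (iter i N (A v))) =
   \sum_(i < d) A (((bump 0 (bump 0 i))`!%:R)^-1 *: N (N (iter i N v))) +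
   \sum_(i < d) B (((bump 0 i)`!%:R)^-1 *: N (iter i N v)) +
   \sum_(i < d) 2%:R^-1 *: C ((i`!%:R)^-1 *: iter i N v).
  rewrite -!big_split; apply: eq_bigr => i _; rewrite /bump /= !add1n.
  rewrite -![N (iter _ _ _)]iterS (iter_comm2 NA NB NC) !linearZ /=.
  by rewrite -(fS i) -(fS i.+1); vring.
by rewrite NA !fact0 ?invr1 ?scale1r; vring.
Qed.

Lemma exp_intertwine N N' A : nilpotent N -> nilpotent N' ->
  (forall v, A (N v) = N' (A v)) -> forall v,
    A (lfun_exp N v) = lfun_exp N' (A v).
Proof.
move=> nN nN' AN v; rewrite !(@lfun_expE _ (\dim {:V})) // linear_sum.
apply: eq_bigr => i _; rewrite linearZ /=; congr (_ *: _).
by elim: (i : nat) => //= n <-.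
Qed.

Lemma exp_comm N v : nilpotent N -> N (lfun_exp N v) = lfun_exp N (N v).
Proof. by move=> nN; apply: exp_intertwine. Qed.

Lemma exp_ker N v : nilpotent N -> N v = 0 -> lfun_exp N v = v.
Proof. by move=> nN Nv; rewrite (@nilpotent_expE _ 1) // big_ord1 fact0 invr1
  scale1r. Qed.

(** If exp(N) kills x, it kills N x as well; by induction on the order of nilpotency at x this gives
    N x = 0, and then x = exp(N) x = 0. *)
Lemma exp_inj N v w : nilpotent N -> lfun_exp N v = lfun_exp N w -> v = w.
Proof.
move=> nN /eqP; rewrite -subr_eq0 -linearB /= => e; apply/eqP;
  rewrite -subr_eq0.
move: (v - w) e (nN (v - w)) => {v w} x /eqP ex; move: (\dim _) => n.
elim: n x ex => [|n IH] x ex; first by move=> /= ->.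
rewrite iterSr => /IH Nx; apply/eqP; rewrite -(exp_ker nN (v := x)) //.
by apply/eqP/Nx; rewrite -exp_comm // ex linear0.
Qed.

Lemma exp_stable N W : nilpotent N -> stable N W -> stable (lfun_exp N) W.
Proof.
move=> nN sN v vW; rewrite (@lfun_expE _ (\dim {:V})) //.
by apply: memv_suml => i _; rewrite memvZ ?iter_stable.
Qed.

Lemma exp_sub_stable N W v : nilpotent N -> stable N W -> N v \in W ->
  lfun_exp N v - v \in W.
Proof.
move=> nN sN NvW; rewrite (@lfun_expE _ (1 + \dim {:V})) => [|x];
  last exact: nilpotent_addn.
rewrite add1n big_ord_recl fact0 invr1 scale1r addrAC subrr add0r.
by apply: memv_suml => i _; rewrite memvZ // iterSr iter_stable.
Qed.

End Exponential.

(** * Representations of sl2-triples *)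

Section Triple.
Variables (K : fieldType) (V : vectType K) (E F H : 'End(V)).

Definition sl2_triple :=
  [/\ forall v, E (F v) = F (E v) + H v,
      forall v, H (E v) = E (H v) + 2%:R *: E v &
      forall v, H (F v) = F (H v) - 2%:R *: F v].

Hypothesis char0 : forall n, n.+1%:R != 0 :> K.
Hypothesis triple : sl2_triple.
Implicit Types (W U : {vspace V}) (v x : V).

Local Notation N := (\dim {:V}).
Local Notation naturals n := (mkseq (fun i => i%:R : K) n).

Lemma EF v : E (F v) = F (E v) + H v. Proof. by case: triple. Qed.
Lemma HE v : H (E v) = E (H v) + 2%:R *: E v. Proof. by case: triple. Qed.
Lemma HF v : H (F v) = F (H v) - 2%:R *: F v. Proof. by case: triple. Qed.

Lemma nilE : nilpotent E.
Proof. exact: (ad_eigen_nilpotent char0 (char0 1) HE). Qed.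

Lemma nilF : nilpotent F.
Proof.
have n2 : - 2%:R != 0 :> K by rewrite oppr_eq0 (char0 1).
by apply: (@ad_eigen_nilpotent _ _ char0 H F _ n2) => v; rewrite HF scaleNr.
Qed.

(** * Highest weight vectors *)

Lemma H_iterF j v : H (iter j F v) = iter j F (H v) - (2%:R * j%:R) *: iter j F v.
Proof.
elim: j => [|j IH]; first by rewrite mulr0 scale0r subr0.
by rewrite /= HF IH [F (_ - _)]linearB /= [F (_ *: _)]linearZ /= -natr1; vring.
Qed.

Lemma E_iterF j v : E (iter j.+1 F v) =
  iter j.+1 F (E v) + j.+1%:R *: iter j F (H v - j%:R *: v).
Proof.
elim: j v => [|j IH] v; first by rewrite /= EF scale0r subr0 scale1r.
rewrite iterSr IH EF iter_lfunD -iterSr -addrA; congr (_ + _).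
have -> : H (F v) - j%:R *: F v = F (H v - (2%:R + j%:R) *: v).
  by rewrite HF [F (_ - _)]linearB /= [F (_ *: _)]linearZ /=; vring.
rewrite -iterSr -!iter_lfunZ -iter_lfunD; congr iter.
by rewrite -!natr1; vring.
Qed.

(* [v] is a highest weight vector of weight [m], or zero. *)
Definition hw v m := E v = 0 /\ H v = m%:R *: v.

Lemma hw_weight v m j : hw v m ->
  H (iter j F v) = (m%:R - 2%:R * j%:R) *: iter j F v.
Proof. by case=> _ Hv; rewrite H_iterF Hv iter_lfunZ scalerBl. Qed.

Lemma hw_E v m j : hw v m ->
  E (iter j.+1 F v) = (j.+1%:R * (m%:R - j%:R)) *: iter j F v.
Proof.
by case=> Ev Hv; rewrite E_iterF Ev iter_lfun0 add0r Hv -scalerBl iter_lfunZ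
  scalerA.
Qed.

Lemma hw_coef_neq0 m j : (j < m)%N -> j.+1%:R * (m%:R - j%:R) != 0 :> K.
Proof.
move=> jm; rewrite mulf_neq0 // subr_eq0.
by apply: contraTneq jm => /(natr_inj char0)->; rewrite ltnn.
Qed.

Lemma hw_lift v m j : hw v m -> (j < m)%N ->
  iter j F v = E ((j.+1%:R * (m%:R - j%:R))^-1 *: iter j.+1 F v).
Proof.
move=> hv jm.
by rewrite linearZ /= (hw_E j hv) scalerA mulVf ?scale1r ?hw_coef_neq0.
Qed.

(** By [E_iterF], one step replaces x by n + 1 times y = (H - n) x modulo [W], and E y stays in
    [W]. *)
Lemma EnFn_mod W x n : stable E W -> stable F W -> stable H W -> E x \in W ->
  iter n E (iter n F x) - n`!%:R *: shifts H (naturals n) x \in W.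
Proof.
move=> sE sF sH; elim: n x => [|n IH] x ExW.
  by rewrite shifts_nil scale1r subrr mem0v.
rewrite iterSr E_iterF iter_lfunD iter_lfunZ mkseqS shifts_rcons.
set y := H x - n%:R *: x.
have EyW : E y \in W.
  rewrite /y linearB linearZ /= memvB ?memvZ //.
  by rewrite -[E _](addrK (2%:R *: E x)) -HE memvB ?sH ?memvZ.
rewrite factS natrM -scalerA -addrA -scalerBr memvD ?memvZ ?IH //.
by rewrite iter_stable ?iter_stable.
Qed.

(** For n = dim V the power F^n vanishes, so modulo [W] a polynomial in H with simple natural roots
    annihilates every vector that E kills. *)
Lemma shifts_naturals_mod W x : stable E W -> stable F W -> stable H W ->
  E x \in W ->
  shifts H (naturals N) x \in W.
Proof.
move=> sE sF sH /(EnFn_mod N sE sF sH).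
rewrite nilF iter_lfun0 sub0r memvN => /(memvZ (N`!%:R)^-1).
by rewrite scalerA mulVf ?scale1r // factr_neq0.
Qed.

Lemma shifts_naturals x : E x = 0 -> shifts H (naturals N) x = 0.
Proof.
move=> Ex; apply/eqP; rewrite -memv0.
by apply: shifts_naturals_mod; rewrite ?Ex ?mem0v //; apply: stable0.
Qed.

Lemma weight_natural x a : E x = 0 -> H x = a *: x -> x != 0 ->
  exists2 m, (m < N)%N & a = m%:R.
Proof.
move=> /shifts_naturals + Hx x0; rewrite (shifts_eigen _ Hx) => /eqP.
rewrite scaler_eq0 (negPf x0) orbF prod_sub_eq0 => /mapP[m].
by rewrite mem_iota => /andP[_ mN] ->; exists m.
Qed.

(** F^(m+1) v is killed by [E] and has weight -m - 2, which is not a natural number. *)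
Lemma hw_iter_eq0 v m j : hw v m -> (m < j)%N -> iter j F v = 0.
Proof.
move=> hv mj; rewrite -(subnK mj) iterD.
suff -> : iter m.+1 F v = 0 by rewrite iter_lfun0.
apply/eqP; apply: contraT => w0.
have [] := weight_natural _ (hw_weight m.+1 hv) w0.
  by rewrite (hw_E m hv) subrr mulr0 scale0r.
move=> p _ /eqP; rewrite -subr_eq0.
have -> : m%:R - 2%:R * m.+1%:R - p%:R = - (m + p).+2%:R :> K.
  by rewrite -!natr1 natrD; ring.
by rewrite oppr_eq0 (negPf (char0 _)).
Qed.

(** * Spanning of the module by strings *)

Definition hw_space m := (lker E :&: lker (H - m%:R *: \1%VF))%VS.

Lemma hw_spaceP v m : reflect (hw v m) (v \in hw_space m).
Proof.
rewrite memv_cap !memv_ker !lfun_simp subr_eq0.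
by apply: (iffP andP) => -[/eqP ? /eqP ?].
Qed.

(** The bounds on m and j only make the sum finite: [mem_strings] shows that they exclude
    nothing. *)
Definition strings :=
  (\sum_(m < N.+1) \sum_(j < m.+1) lfun_pow F j @: hw_space m)%VS.

Lemma strings_sub W :
  (forall v m j, hw v m -> (j <= m)%N -> iter j F v \in W) -> (strings <= W)%VS.
Proof.
move=> sW; apply/subv_sumP => m _; apply/subv_sumP => j _; apply/subvP => x.
case/memv_imgP => v /hw_spaceP hv ->; rewrite iter_lfun; apply: sW hv _.
by rewrite -ltnS.
Qed.

Lemma mem_strings v m j : hw v m -> iter j F v \in strings.
Proof.
move=> hv; have [->|v0] := eqVneq v 0; first by rewrite iter_lfun0 mem0v.
have [/(hw_iter_eq0 hv)->|jm] := ltnP m j; first exact: mem0v.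
have [p pN /(natr_inj char0) e] := weight_natural hv.1 hv.2 v0.
have mN : (m < N.+1)%N by rewrite e ltnS ltnW.
rewrite -ltnS in jm; rewrite -iter_lfun.
apply: (subvP (sumv_sup (Ordinal mN) isT (subvv _))).
apply: (subvP (sumv_sup (Ordinal jm) isT (subvv _))).
by apply/memv_img/hw_spaceP.
Qed.

Lemma strings_stable : [/\ stable E strings,
  stable F strings & stable H strings].
Proof.
have S (A : 'End(V)) : (forall v m j, hw v m -> A (iter j F v) \in strings) ->
    stable A strings.
  move=> As v vT; rewrite memv_preim; apply: subvP vT.
  by apply: strings_sub => w m j hw _; rewrite -memv_preim; apply: As hw.
split; apply: S => v m j hv.
- case: j => [|j]; first by rewrite /= hv.1 mem0v.
  by rewrite (hw_E j hv) memvZ ?(mem_strings _ hv).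
- by rewrite -iterS (mem_strings _ hv).
by rewrite (hw_weight j hv) memvZ ?(mem_strings _ hv).
Qed.

Lemma E_shifts s x :
  E (shifts H s x) = shifts H [seq a + 2%:R | a <- s] (E x).
Proof.
elim: s x => [|a s IH] x; first by rewrite !shifts_nil.
rewrite shifts_consr IH map_cons shifts_consr; congr (shifts _ _ _).
by rewrite linearB linearZ /= HE; vring.
Qed.

(* Modulo [E @: strings] only the lowest weight vectors [F^m v] survive. *)
Lemma strings_lowest t : t \in strings ->
  shifts H (mkseq (fun i => - i%:R) N) t \in (E @: strings)%VS.
Proof.
move=> tT; rewrite memv_preim; apply: subvP tT; apply: strings_sub => v m j hv.
rewrite leq_eqVlt -memv_preim => /orP[/eqP->|jm].
  have [->|v0] := eqVneq v 0; first by rewrite iter_lfun0 linear0 mem0v.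
  have [p pN /(natr_inj char0) e] := weight_natural hv.1 hv.2 v0.
  rewrite (shifts_eigen_eq0 (hw_weight m hv)) ?mem0v //.
  apply/mapP; exists m; first by rewrite mem_iota e.
  by ring.
rewrite (shifts_eigen _ (hw_weight j hv)) memvZ //.
by rewrite (hw_lift hv jm) memv_img // memvZ // (mem_strings _ hv).
Qed.

(** [H] is diagonalizable on the kernel of [E], being annihilated there by a polynomial with
    distinct roots, and its eigenvectors there are highest weight vectors. *)
Lemma ker_strings x : E x = 0 -> x \in strings.
Proof.
have [_ _ sH] := strings_stable.
move=> Ex; apply: (memv_sum_eigen (A := H) (U := lker E) (s := naturals N)) => //.
- move=> v; rewrite !memv_ker => /eqP Ev.
  by rewrite -[E _](addrK (2%:R *: E v)) -HE Ev scaler0 subr0 linear0.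
- by rewrite map_inj_uniq ?iota_uniq // => m n /(natr_inj char0).
- move=> a v _; rewrite memv_ker => /eqP Ev Hv.
  have [->|v0] := eqVneq v 0; first exact: mem0v.
  have [m _ am] := weight_natural Ev Hv v0.
  by apply: (@mem_strings v m 0); split; rewrite // Hv am.
- by rewrite memv_ker Ex.
exact: shifts_naturals.
Qed.

(* If [E x] lies in the sum [T] of all strings, then [prod_j (H - j) x] does,
   so [E x] is killed in [T / E T] by [prod_j (H - j - 2)].  The eigenvalues of
   [H] there are nonpositive, whence [E x = E t] with [t] in [T], and [x - t] is
   a sum of highest weight vectors. *)
Lemma strings_E x : E x \in strings -> x \in strings.
Proof.
have [sE sF sH] := strings_stable => ExT.
have sW : stable H (E @: strings)%VS.
  move=> y /memv_imgP[t tT ->].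
  by rewrite HE -linearZ -linearD memv_img // memvD ?sH ?memvZ.
have : E x \in (E @: strings)%VS.
  apply: (@memv_shifts_coprime _ _ _ _ [seq a + 2%:R | a <- naturals N] _ _
    sW _ _ (strings_lowest ExT)).
    2: by rewrite -E_shifts memv_img // shifts_naturals_mod.
  move=> _ /mapP[_ /mapP[i _ ->] ->]; apply/negP => /mapP[j _ /eqP].
  rewrite -subr_eq0.
  have -> : i%:R + 2%:R - - j%:R = (i + j).+2%:R :> K by rewrite -!natr1 natrD; ring.
  by rewrite (negPf (char0 _)).
case/memv_imgP => t tT e; rewrite -[x](subrK t) memvD // ker_strings //.
by rewrite linearB /= e subrr.
Qed.

Lemma strings_full : strings = fullv.
Proof.
apply/eqP; rewrite eqEsubv subvf; apply/subvP => x _.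
have := nilE x; move: N => n; elim: n x => [|n IH] x; first by move=> /= ->;
  rewrite mem0v.
by rewrite iterSr => /IH/strings_E.
Qed.

(** * Single strings and irreducibility *)

Definition string n v : {vspace V} := <<mkseq (fun j => iter j F v) n>>%VS.

Lemma mem_string n v j : (j < n)%N -> iter j F v \in string n v.
Proof. by move=> jn; apply/memv_span/map_f; rewrite mem_iota. Qed.

Lemma string_sub W n v : (forall j,
  (j < n)%N -> iter j F v \in W) -> (string n v <= W)%VS.
Proof. by move=> sW; apply/span_subvP => x /mapP[j]; rewrite mem_iota => jn ->;
  apply: sW. Qed.

Lemma string_stable (A : 'End(V)) n v :
  (forall j, (j < n)%N -> A (iter j F v) \in string n v) ->
    stable A (string n v).
Proof.
move=> sA x; rewrite memv_preim; apply: subvP; apply: string_sub => j jn.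
by rewrite -memv_preim sA.
Qed.

Lemma string_stableE n m v : hw v m -> stable E (string n v).
Proof.
move=> hv; apply: string_stable => -[|j] jn; first by rewrite /= hv.1 mem0v.
by rewrite (hw_E j hv) memvZ // mem_string // ltnW.
Qed.

Lemma string_stableH n m v : hw v m -> stable H (string n v).
Proof.
by move=> hv; apply: string_stable => j jn;
  rewrite (hw_weight j hv) memvZ // mem_string.
Qed.

Lemma string_stableF m v : hw v m -> stable F (string m.+1 v).
Proof.
move=> hv; apply: string_stable => j _; rewrite -iterS.
have [lt|ge] := ltnP j.+1 m.+1; first exact: mem_string.
by rewrite (hw_iter_eq0 hv) ?mem0v.
Qed.

Lemma string_lowest m v : hw v m -> E (iter m F v) \in string m v.
Proof.
case: m => [|m] hv; first by rewrite /= hv.1 mem0v.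
by rewrite (hw_E m hv) memvZ // mem_string.
Qed.

Lemma weight_inj (m : nat) : injective (fun j => m%:R - 2%:R * j%:R : K).
Proof.
move=> i j /addrI/oppr_inj/(mulfI (char0 1)); exact: natr_inj.
Qed.

(** The weights are distinct, and [E] takes F^(j+1) v to a nonzero multiple of F^j v for j < m, so
    no vector of the string vanishes. *)
Lemma string_free n m v : hw v m -> v != 0 -> (n <= m.+1)%N ->
  free (mkseq (fun j => iter j F v) n).
Proof.
move=> hv v0 nm; apply: (eigen_free (@weight_inj m) (fun j =>
  hw_weight j hv)) => j jn.
have {nm jn} : (j < m.+1)%N by apply: leq_trans nm.
elim: j => [//|j IH]; rewrite ltnS => jm.
apply: contraNneq (IH (ltnW jm)) => w0.
move: (hw_E j hv); rewrite w0 linear0 => /esym/eqP.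
by rewrite scaler_eq0 (negPf (hw_coef_neq0 jm)).
Qed.

Lemma dim_string n m v : hw v m -> v != 0 -> (n <= m.+1)%N ->
  \dim (string n v) = n.
Proof. by move=> hv v0 /(string_free hv v0)/eqP; rewrite size_mkseq. Qed.

(* [E] maps the string onto a space of codimension one in it, so that the
   kernel of [E] on the string is the line of [v]. *)
Lemma string_ker m v x : hw v m -> v != 0 -> x \in string m.+1 v -> E x = 0 ->
  x \in <[v]>%VS.
Proof.
move=> hv v0 xS Ex.
have lv : (<[v]> <= string m.+1 v :&: lker E)%VS.
  by rewrite -memvE memv_cap memv_ker hv.1 eqxx andbT;
    apply: (@mem_string _ _ 0).
have <- : (string m.+1 v :&: lker E)%VS = <[v]>%VS;
  last by rewrite memv_cap memv_ker xS Ex eqxx.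
apply/esym/eqP; rewrite eqEdim lv dim_vline v0.
have := limg_ker_dim E (string m.+1 v); rewrite (dim_string hv) // => e.
have sub : (string m v <= E @: string m.+1 v)%VS.
  apply: string_sub => j jm.
  by rewrite (hw_lift hv jm) memv_img // memvZ // mem_string.
have := dimvS sub; rewrite (dim_string hv) //; lia.
Qed.

Lemma exists_kerE W : stable E W -> W != 0%VS -> exists2 u,
  u \in W & u != 0 /\ E u = 0.
Proof.
move=> sE W0; have := nilE (vpick W).
have : vpick W != 0 by rewrite vpick0.
move: N (vpick W) (memv_pick W) => n w wW w0.
elim: n w wW w0 => [|n IH] w wW w0; first by move=> e; rewrite /= in e;
  rewrite e eqxx in w0.
rewrite iterSr; have [Ew _|Ew0] := eqVneq (E w) 0; first by exists w.
by apply: IH; rewrite ?sE.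
Qed.

(** [H] preserves the intersection of [W] with the kernel of [E] and satisfies a split polynomial
    there, so it has an eigenvector. *)
Lemma exists_hw W : stable E W -> stable H W -> W != 0%VS ->
  exists m v, [/\ v \in W, v != 0 & hw v m].
Proof.
move=> sE sH /(exists_kerE sE)[u uW [u0 Eu]].
have sK : stable H (W :&: lker E)%VS.
  move=> v; rewrite !memv_cap !memv_ker => /andP[vW /eqP Ev].
  by rewrite sH //= -[E _](addrK (2%:R *: E v)) -HE Ev scaler0 subr0 linear0.
have uK : u \in (W :&: lker E)%VS by rewrite memv_cap uW memv_ker Eu eqxx.
have [a [v [_ vK v0 Hv]]] := shifts_eq0_eigen sK uK u0 (shifts_naturals Eu).
move: vK; rewrite memv_cap memv_ker => /andP[vW /eqP Ev].
have [m _ am] := weight_natural Ev Hv v0.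
by exists m, v; split=> //; split; rewrite // -am.
Qed.

(** A nonzero [W] contains a nonzero vector killed by [E]; by [string_ker] it is a multiple of v,
    and v generates the string under [F]. *)
Lemma string_irreducible m v W : hw v m -> v != 0 -> stable E W -> stable F W ->
  (W <= string m.+1 v)%VS -> W = 0%VS \/ W = string m.+1 v.
Proof.
move=> hv v0 sE sF sub; have [->|W0] := eqVneq W 0%VS; first by left.
right; apply/eqP; rewrite eqEsubv sub /=.
have [u uW [u0 Eu]] := exists_kerE sE W0.
have /vlineP[c uc] := string_ker hv v0 (subvP sub _ uW) Eu.
have c0 : c != 0 by apply: contraNneq u0 => c0; rewrite uc c0 scale0r.
apply: string_sub => j _; apply: iter_stable => //.
by rewrite -[v]scale1r -(mulVf c0) -scalerA -uc memvZ.
Qed.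

(** * The Weyl element *)

Definition weyl : 'End(V) := (lfun_exp (- F) \o lfun_exp E \o lfun_exp (- F))%VF.

Lemma nilNF : nilpotent (- F).
Proof. exact: nilpotentN nilF. Qed.

Lemma weylE v : weyl v = lfun_exp (- F) (lfun_exp E (lfun_exp (- F) v)).
Proof. by rewrite /weyl !comp_lfunE. Qed.

Lemma half2 : 2%:R^-1 * 2%:R = 1 :> K.
Proof. by rewrite mulVf // (char0 1). Qed.

(** This is exp(ad(-F)) E, from [-F, E] = H, [-F, H] = -2F and [-F, F] = 0. *)
Lemma expNF_E v : lfun_exp (- F) (E v) =
  E (lfun_exp (- F) v) + H (lfun_exp (- F) v) - F (lfun_exp (- F) v).
Proof.
rewrite (exp_conj2 char0 (N := - F) (B := H) (C := - (2%:R *: F)) nilNF).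
- by rewrite opp_lfunE scale_lfunE scalerN scalerA half2 scale1r.
- by move=> w; rewrite !opp_lfunE linearN /= EF; vring.
- by move=> w; rewrite !opp_lfunE scale_lfunE linearN /= HF; vring.
by move=> w; rewrite !opp_lfunE !scale_lfunE !linearN linearZ.
Qed.

Lemma expNF_H v : lfun_exp (- F) (H v) =
  H (lfun_exp (- F) v) - 2%:R *: F (lfun_exp (- F) v).
Proof.
rewrite (exp_conj2 char0 (N := - F) (B := - (2%:R *: F)) (C := 0) nilNF).
- by rewrite zero_lfunE scaler0 addr0 opp_lfunE scale_lfunE.
- by move=> w; rewrite !opp_lfunE scale_lfunE linearN /= HF; vring.
- by move=> w; rewrite !opp_lfunE !scale_lfunE !linearN /= zero_lfunE linearZ addr0.
by move=> w; rewrite !zero_lfunE linear0.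
Qed.

Lemma expE_F v : lfun_exp E (F v) =
  F (lfun_exp E v) + H (lfun_exp E v) - E (lfun_exp E v).
Proof.
rewrite (exp_conj2 char0 (N := E) (B := H) (C := - (2%:R *: E)) nilE).
- by rewrite opp_lfunE scale_lfunE scalerN scalerA half2 scale1r.
- exact: EF.
- by move=> w; rewrite !opp_lfunE scale_lfunE HE; vring.
by move=> w; rewrite !opp_lfunE !scale_lfunE linearN linearZ /=.
Qed.

Lemma expE_H v : lfun_exp E (H v) = H (lfun_exp E v) - 2%:R *: E (lfun_exp E v).
Proof.
rewrite (exp_conj2 char0 (N := E) (B := - (2%:R *: E)) (C := 0) nilE).
- by rewrite zero_lfunE scaler0 addr0 opp_lfunE scale_lfunE.
- by move=> w; rewrite !opp_lfunE scale_lfunE HE; vring.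
- by move=> w; rewrite !opp_lfunE !scale_lfunE !linearN /= zero_lfunE linearZ addr0.
by move=> w; rewrite !zero_lfunE linear0.
Qed.

Lemma expNF_F v : lfun_exp (- F) (F v) = F (lfun_exp (- F) v).
Proof. by rewrite (exp_intertwine (A := F) nilNF nilNF) // => w;
  rewrite !opp_lfunE linearN. Qed.

(** Conjugating by the three factors in turn, F becomes F, then F + H - E, then -E. *)
Lemma weyl_F v : weyl (F v) = - E (weyl v).
Proof.
rewrite !weylE expNF_F expE_F; set w := lfun_exp E _.
rewrite !raddfD /= raddfN /= expNF_F expNF_H expNF_E; vring.
Qed.

Lemma weyl_H v : weyl (H v) = - H (weyl v).
Proof.
rewrite !weylE expNF_H raddfB /= linearZ /= expE_F expE_H;
  set w := lfun_exp E _.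
have -> : H w - 2%:R *: E w - 2%:R *: (F w + H w - E w) = - (H w + 2%:R *: F w)
  by vring.
by rewrite raddfN raddfD /= linearZ /= expNF_H expNF_F; vring.
Qed.

Lemma weyl_E v : weyl (E v) = - F (weyl v).
Proof.
rewrite !weylE expNF_E [lfun_exp E (_ - _)]raddfB /= [lfun_exp E (_ + _)]raddfD
  /= -(exp_comm _ nilE) expE_F expE_H.
set w := lfun_exp E _.
have -> : E w + (H w - 2%:R *: E w) - (F w + H w - E w) = - F w by vring.
by rewrite raddfN /= expNF_F.
Qed.

(* With [a = exp(-F)] and [b = exp(E)], the relation [weyl E = - F weyl] gives
   [(a b a) b = a (a b a)]; cancel [a] on the left. *)
Lemma weyl_braid v : weyl v = lfun_exp E (lfun_exp (- F) (lfun_exp E v)).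
Proof.
apply: (exp_inj nilNF); rewrite -weylE; apply/esym.
apply: (exp_intertwine (A := weyl) nilE nilNF) => w.
by rewrite weyl_E opp_lfunE.
Qed.

(** Both sides have weight -m and agree modulo the span [W] of the F^j v with j < m; the weights m -
    2j in [W] differ from -m, so the difference is zero. *)
Lemma weyl_hw v m : hw v m -> weyl v = ((m`!%:R)^-1 * (-1) ^+ m) *: iter m F v.
Proof.
move=> hv; have [->|v0] := eqVneq v 0; first by rewrite iter_lfun0 !linear0.
set f := _ *: _; pose W := string m v.
have sE : stable E W := string_stableE hv.
have f_lowest : E f \in W.
  by rewrite /f linearZ memvZ // string_lowest.
have aW : lfun_exp (- F) v - f \in W.
  rewrite (@nilpotent_expE _ _ _ m.+1 _ nilNF) => [|].
    rewrite big_ord_recr /= iter_lfunN scalerA addrK.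
    by apply: memv_suml => i _; rewrite iter_lfunN !memvZ ?mem_string.
  by rewrite iter_lfunN (hw_iter_eq0 hv) ?scaler0.
have uW : weyl v - f \in W.
  (* Since exp(E) fixes v, the braid form leaves exp(E) exp(-F) v; modulo [W] the inner factor gives
     f, and exp(E) fixes f because E f lies in [W]. *)
  rewrite weyl_braid (exp_ker nilE hv.1).
  have -> : lfun_exp E (lfun_exp (- F) v) - f =
    lfun_exp E (lfun_exp (- F) v - f) + (lfun_exp E f - f) by rewrite raddfB /=
      addrA subrK.
  by rewrite memvD ?exp_stable ?exp_sub_stable //; apply: nilE.
have Hu : H (weyl v - f) = (- m%:R) *: (weyl v - f).
  rewrite raddfB /= linearZ /= (hw_weight m hv) -[H (weyl v)]opprK -weyl_H hv.2
    linearZ /= /f.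
  by vring.
have := span_shifts (fun j => hw_weight j hv) uW.
rewrite (shifts_eigen _ Hu) => /eqP; rewrite scaler_eq0 subr_eq0 prod_sub_eq0.
case/orP => [/mapP[j]|/eqP//]; rewrite mem_iota add0n => /= jm /eqP.
rewrite -subr_eq0.
have -> : - m%:R - (m%:R - 2%:R * j%:R) = - (2%:R * (m%:R - j%:R)) :> K by ring.
rewrite oppr_eq0 mulf_eq0 (negPf (char0 1)) /= subr_eq0 =>
  /eqP/(natr_inj char0) e.
by rewrite e ltnn in jm.
Qed.

(** The case W = 0 of [EnFn_mod]; the product of the m - i over i < m is a second m!. *)
Lemma EmFm_hw m v : hw v m -> iter m E (iter m F v) = (m`!%:R * m`!%:R) *: v.
Proof.
case=> Ev Hv; have Z (A : 'End(V)) : stable A 0%VS := @stable0 _ _ A.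
have := EnFn_mod m (Z E) (Z F) (Z H) (x := v).
rewrite Ev mem0v memv0 subr_eq0 => /(_ isT)/eqP->.
rewrite (shifts_eigen _ Hv) scalerA; congr (_ * _ *: _).
rewrite -[in RHS]ffactnn ffact_prod natr_prod big_map -[X in iota 0 X]subn0
  big_mkord.
by apply: eq_bigr => i _; rewrite natrB // ltnW.
Qed.

Lemma weyl_iterF j v : weyl (iter j F v) = (-1) ^+ j *: iter j E (weyl v).
Proof.
elim: j => [|j IH]; first by rewrite scale1r.
by rewrite /= weyl_F IH linearZ /= exprS mulN1r scaleNr.
Qed.

(** Since h F^m = (-1)^m E^m h, the second application brings in E^m F^m v = (m!)^2 v, which cancels
    both factors 1 / m!; the three signs (-1)^m reduce to one. *)
Lemma weyl2_hw m v : hw v m -> weyl (weyl v) = (-1) ^+ m *: v.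
Proof.
move=> hv; rewrite (weyl_hw hv) linearZ /= weyl_iterF (weyl_hw hv) iter_lfunZ.
rewrite (EmFm_hw hv) !scalerA; congr (_ *: _).
have := factr_neq0 char0 m; set f := _%:R => f0.
have e : (-1) ^+ m * (-1) ^+ m = 1 :> K by rewrite -exprD -signr_odd oddD addbb.
move: ((-1) ^+ m) e => s e; rewrite -[RHS]mul1r -e.
by field.
Qed.

Lemma weyl2_F v : weyl (weyl (F v)) = F (weyl (weyl v)).
Proof. by rewrite weyl_F linearN /= weyl_E opprK. Qed.

Lemma weyl2_string m v x : hw v m -> x \in string m.+1 v ->
  weyl (weyl x) = (-1) ^+ m *: x.
Proof.
move=> hv xS; apply/eqP.
suff /subvP/(_ x xS) : (string m.+1 v <=
    lker ((weyl \o weyl)%VF - (-1) ^+ m *: \1%VF))%VS.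
  by rewrite memv_ker add_lfunE opp_lfunE scale_lfunE id_lfunE comp_lfunE
    subr_eq0.
apply: string_sub => j _; rewrite memv_ker add_lfunE opp_lfunE scale_lfunE
  id_lfunE comp_lfunE subr_eq0; apply/eqP.
elim: j => [|j IH]; first exact: weyl2_hw.
by rewrite /= weyl2_F IH linearZ.
Qed.

End Triple.

(** * The operators h, k and s *)

Section Module.
Variables (K : fieldType) (im : K) (M : sl2_module im).
Hypothesis char0 : forall n, n.+1%:R != 0 :> K.
Hypothesis im_sqr : im ^+ 2 = -1.
Implicit Types (U W : {vspace M}) (v : M).

Local Notation X := (opX M).
Local Notation Y := (opY M).
Local Notation H := (opZ M).
Local Notation E := (Nplus M).
Local Notation F := (- Nminus M).

(** For identities that hold only modulo im^2 = -1: [c] is the cofactor of im^2 + 1, and the premise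
    is left to [field]. *)
Lemma eq_mod_im a b c : a - b = (im ^+ 2 + 1) * c -> a = b.
Proof. by rewrite im_sqr addNr mul0r => /eqP; rewrite subr_eq0 => /eqP. Qed.

Lemma opXY v : X (Y v) = Y (X v) + (2%:R * im) *: H v.
Proof.
have := sl2_act_bracket M (sl2X K) (sl2Y K); rewrite sl2_bracketXY linearZ /=.
by move/lfunP/(_ v); rewrite !lfun_simp => ->; rewrite addrC subrK.
Qed.

Lemma opYZ v : Y (H v) = H (Y v) + (2%:R * im) *: X v.
Proof.
have := sl2_act_bracket M (sl2Y K) (sl2Z K); rewrite sl2_bracketYZ linearZ /=.
by move/lfunP/(_ v); rewrite !lfun_simp => ->; rewrite addrC subrK.
Qed.

Lemma opZX v : H (X v) = X (H v) + (2%:R * im) *: Y v.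
Proof.
have := sl2_act_bracket M (sl2Z K) (sl2X K); rewrite sl2_bracketZX linearZ /=.
by move/lfunP/(_ v); rewrite !lfun_simp => ->; rewrite addrC subrK.
Qed.

Lemma E_XY v : E v = 2%:R^-1 *: (im *: Y v + X v).
Proof. by rewrite /Nplus !lfun_simp. Qed.

Lemma F_XY v : F v = 2%:R^-1 *: (X v - im *: Y v).
Proof. by rewrite /Nminus !lfun_simp -scalerN opprB. Qed.

Lemma X_EF v : X v = E v + F v.
Proof.
rewrite E_XY F_XY; apply: coordinateP => i; rewrite !coordinateE; field;
  exact: char0.
Qed.

Lemma Y_EF v : Y v = im *: (F v - E v).
Proof.
rewrite E_XY F_XY; apply: coordinateP => i; rewrite !coordinateE.
transitivity (- im ^+ 2 * coordinate i (Y v)); first by rewrite im_sqr; ring.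
by field; exact: char0.
Qed.

Lemma opEF v : E (F v) = F (E v) + H v.
Proof.
rewrite !(E_XY, F_XY) !linearZ /= !linearD /= !linearN /= !linearZ /= opXY.
apply: coordinateP => i; rewrite !coordinateE.
by apply: (@eq_mod_im _ _ (- coordinate i (H v))); field; exact: char0.
Qed.

Lemma opHE v : H (E v) = E (H v) + 2%:R *: E v.
Proof.
rewrite !E_XY !linearZ /= !linearD /= !linearZ /= opYZ opZX.
apply: coordinateP => i; rewrite !coordinateE.
by apply: (@eq_mod_im _ _ (- coordinate i (X v))); field; exact: char0.
Qed.

Lemma opHF v : H (F v) = F (H v) - 2%:R *: F v.
Proof.
rewrite !F_XY !linearZ /= !linearD /= !linearN /= !linearZ /= opYZ opZX.
apply: coordinateP => i; rewrite !coordinateE.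
by apply: (@eq_mod_im _ _ (coordinate i (X v))); field; exact: char0.
Qed.

Lemma op_triple : sl2_triple E F H.
Proof. split; [exact: opEF | exact: opHE | exact: opHF]. Qed.

(** X, Y and E, F have the same span, and H is Z itself. *)
Lemma submoduleP U : submodule U <-> [/\ stable E U, stable F U & stable H U].
Proof.
have S (A : 'End(M)) : (A @: U <= U)%VS <-> stable A U.
  split=> [/subvP sA v vU|sA]; first by apply/sA/memv_img.
  by apply/subvP => _ /memv_imgP[v vU ->]; apply: sA.
split=> [sU|[sE sF sH] u].
  have sX : stable X U by apply/S/sU.
  have sY : stable Y U by apply/S/sU.
  split; last by apply/S/sU.
    by move=> v vU; rewrite E_XY !(memvZ, memvD) ?sX ?sY.
  by move=> v vU; rewrite F_XY memvZ // memvB ?memvZ ?sX ?sY.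
apply/S => v vU.
have -> : u = u 0 0 *: sl2X K + u 0 1 *: sl2Y K + u 0 2%:R *: sl2Z K.
  by apply/rowP => -[[|[|[|n]]] h] //;
    rewrite !mxE /= !(mulr0, mulr1, addr0, add0r);
    congr (u 0 _); apply: val_inj.
rewrite !linearD !linearZ /= !lfun_simp -/X -/Y -/H !memvD ?memvZ ?sH //.
  by rewrite X_EF memvD ?sE ?sF.
by rewrite Y_EF memvZ // memvB ?sE ?sF.
Qed.

Lemma op_hE : op_h M = weyl E F.
Proof. by rewrite /weyl opprK. Qed.

Local Notation hw := (hw E H).
Local Notation h := (op_h M).

Lemma irreducible_string m v : hw v m -> v != 0 ->
  irreducible_submodule (string F m.+1 v).
Proof.
move=> hv v0; split.
- apply/submoduleP; split.
  + exact: (string_stableE op_triple hv).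
  + exact: (string_stableF char0 op_triple hv).
  + exact: (string_stableH op_triple hv).
- by rewrite -dimv_eq0 (dim_string char0 op_triple hv).
move=> W /submoduleP[sE sF _].
exact: (string_irreducible char0 op_triple hv v0).
Qed.

(** [U] contains a highest weight vector, of weight m say, and equals its string by irreducibility;
    its dimension is m + 1, so the scalar (-1)^m of h^2 depends on the parity of the dimension. *)
Lemma irreducible_op_h U v : irreducible_submodule U -> v \in U ->
  h (h v) = if odd (\dim U) then v else - v.
Proof.
case=> /submoduleP[sE sF sH] U0 irrU vU; rewrite op_hE.
have [m [w [wU w0 hw]]] := exists_hw char0 op_triple sE sH U0.
have [sS S0 _] := irreducible_string hw w0.
have sub : (string F m.+1 w <= U)%VS by apply: string_sub => j _;
  apply: iter_stable.
have eU : string F m.+1 w = U by case: (irrU _ sS sub) => // e;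
  rewrite e eqxx in S0.
rewrite (weyl2_string char0 op_triple hw) ?eU //.
rewrite -eU (dim_string char0 op_triple hw) //= -signr_odd.
by case: (odd m); rewrite ?scale1r ?scaleN1r.
Qed.

(** Complete reducibility in the form needed: each spanning vector F^j w of [strings_full] with w
    nonzero lies in an irreducible string. *)
Lemma eq_on_irreducibles (f g : 'End(M)) :
  (forall U v, irreducible_submodule U -> v \in U -> f v = g v) -> f = g.
Proof.
move=> fg; apply/lfunP => v; apply/eqlfunP; apply: subvP (memvf v).
rewrite -(strings_full char0 op_triple); apply: strings_sub => w m j hw jm.
have [->|w0] := eqVneq w 0; first by rewrite iter_lfun0 mem0v.
by apply/eqlfunP/(fg _ _ (irreducible_string hw w0))/mem_string.
Qed.

(* On each irreducible submodule [h^2] is [1] or [-1] according to the parity of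
   its dimension, so [k] is the affine function of [h^2] with these values. *)
Definition k_poly : 'End(M) :=
  (2%:R^-1 * (1 - im)) *: \1%VF + (2%:R^-1 * (1 + im)) *: (h \o h)%VF.

Lemma k_polyE v : k_poly v = (2%:R^-1 * (1 - im)) *: v + (2%:R^-1 * (1 + im))
  *: h (h v).
Proof. by rewrite /k_poly !lfun_simp. Qed.

Lemma k_polyP : is_op_k k_poly.
Proof.
move=> U irrU v vU; rewrite k_polyE (irreducible_op_h irrU vU).
by case: odd; apply: coordinateP => i; rewrite !coordinateE; field;
  exact: char0.
Qed.

Lemma op_kE : op_k M = k_poly.
Proof.
apply: eq_on_irreducibles => U v irrU vU; rewrite (k_polyP irrU vU).
(* [k_poly] satisfies the predicate, so [xget] does not fall back on its default 0. *)
have : is_op_k (op_k M) by rewrite /op_k;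
  case: xgetP => [_ -> //|/(_ k_poly)[]]; exact: k_polyP.
exact.
Qed.

Lemma op_sE v : op_s M v = h (k_poly v).
Proof. by rewrite /op_s comp_lfunE op_kE. Qed.

Lemma op_h_k v : h (k_poly v) = k_poly (h v).
Proof. by rewrite !k_polyE linearD !linearZ. Qed.

(** [A] commutes with h^2, as moving it across h twice costs c^2 = 1. The values c = 1 and c = -1
    cover X, Y and Z. *)
Lemma k_poly_comm (A : 'End(M)) c : c * c = 1 -> (forall v,
  h (A v) = c *: A (h v)) ->
  forall v, k_poly (A v) = A (k_poly v).
Proof.
move=> cc hA v; rewrite !k_polyE hA linearZ /= hA scalerA cc scale1r.
by rewrite [A (_ + _)]linearD /= ![A (_ *: _)]linearZ.
Qed.

Lemma op_s_comm (A : 'End(M)) c : c * c = 1 -> (forall v,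
  h (A v) = c *: A (h v)) ->
  (op_s M \o A)%VF = c *: (A \o op_s M)%VF.
Proof.
move=> cc hA; apply/lfunP => v.
by rewrite scale_lfunE [LHS]comp_lfunE [X in _ *: X]comp_lfunE !op_sE
  (k_poly_comm cc hA) hA.
Qed.

Lemma op_s_involutive : (op_s M \o op_s M)%VF = \1%VF.
Proof.
apply: eq_on_irreducibles => U v irrU vU.
rewrite comp_lfunE id_lfunE !op_sE -op_h_k.
have kU := k_polyP irrU; have hU x := @irreducible_op_h U x irrU.
(* In even dimension k^2 = (-i)^2 = -1, which cancels h^2 = -1 there. *)
have kk : k_poly (k_poly v) = if odd (\dim U) then v else - v.
  rewrite (kU v vU); case: ifP => od; first by rewrite (kU v vU) od.
  by rewrite linearZ /= (kU v vU) od scalerA mulrNN -expr2 im_sqr scaleN1r.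
by rewrite kk; case: ifP kk => od _; rewrite ?linearN /= hU // od ?opprK.
Qed.

Lemma op_h_X v : h (X v) = - X (h v).
Proof.
rewrite !X_EF linearD /= op_hE (weyl_E char0 op_triple) (weyl_F char0
  op_triple).
by rewrite opprD addrC.
Qed.

Lemma op_h_Y v : h (Y v) = Y (h v).
Proof.
rewrite !Y_EF linearZ linearB /= op_hE (weyl_E char0 op_triple).
by rewrite (weyl_F char0 op_triple) opprK addrC.
Qed.

Lemma op_h_Z v : h (H v) = - H (h v).
Proof. by rewrite op_hE (weyl_H char0 op_triple). Qed.

Lemma op_s_skew : [/\ (op_s M \o op_s M)%VF = \1%VF,
  (op_s M \o X)%VF = - (X \o op_s M)%VF,
  (op_s M \o Y)%VF = (Y \o op_s M)%VF &
  (op_s M \o H)%VF = - (H \o op_s M)%VF].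
Proof.
have m1 : -1 * -1 = 1 :> K by rewrite mulrNN mulr1.
split; first exact: op_s_involutive.
- by rewrite -scaleN1r (op_s_comm m1) // => v; rewrite scaleN1r op_h_X.
- by rewrite -[RHS]scale1r (op_s_comm (mulr1 1)) // => v;
    rewrite scale1r op_h_Y.
by rewrite -scaleN1r (op_s_comm m1) // => v; rewrite scaleN1r op_h_Z.
Qed.

End Module.

Theorem theorem5p14 (K : closedFieldType) (im : K)
    (char0 : [pchar K] =i pred0) (im_sqr : im ^+ 2 = -1) :
  skew_operator (@op_s K im).
Proof.
move=> M; apply: op_s_skew im_sqr => n.
by rewrite ((pcharf0P K).1 char0).
Qed.
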